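(* Assume the polytopic dynamics and the SOS settings (i)–(iv) described in the context. Then the following hold. (i) There exists a feasible solution $(Q_*,H_*,S_{1*},\dots,S_{K*},\epsilon_{1*})$ to the problem $$\max_{Q,H,S_1,\dots,S_K,\epsilon_1}\epsilon_1\quad\text{s.t.}\quad\begin{cases}\forall k,\ \forall x:\ Y_k(x,Q,H)+Y_k(x,Q,H)^\top=(\zeta(x)\otimes I_{d_z})^\top S_k(\zeta(x)\otimes I_{d_z}),\\ \forall k:\ S_k=S_k^\top\succeq\epsilon_1I_{d_\zeta d_z},\\ Q=Q^\top\succeq\epsilon_1I_{d_z},\\ \epsilon_1>0,\end{cases}\qquad(\mathrm{A})$$ where $Q\in\mathbb{R}^{d_z\times d_z}$, $H\in\mathbb{R}^{d_Z\times d_z}$ and $$Y_k(x,Q,H):=-\frac{\partial z(x)}{\partial x^\top}\big(F_k(x)Q+G_k(x)Z(x)H\big).$$ (ii) Given a feasible solution to (A), put $w^{\{0\}}:=\mathrm{vec}(H_*Q_*^{-1})$ and $P^{\{0\}}:=Q_*^{-1}$. Then, for some $C_r\in\mathbb{R}^{d_r\times d_\xi(d_\xi+1)/2}$ and $c_r\in\{0,1\}$ in the definition of $T_k$, there exists a feasible solution $r_*$ (together with some $\epsilon_2$) to the problem $$\max_{r,\epsilon_2}\epsilon_2\quad\text{s.t.}\quad\begin{cases}\forall k:\ T_k(w^{\{0\}},P^{\{0\}},r)\succeq\epsilon_2I_{d_\xi},\\ \epsilon_2>0.\end{cases}\qquad(\mathrm{B})$$ (iii) The initial decision variables $w^{\{0\}}=\mathrm{vec}(H_*Q_*^{-1})$,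 $P^{\{0\}}=Q_*^{-1}$, $r^{\{0\}}:=r_*$, with $(Q_*,H_* )$ from a feasible solution to (A) and $r_*$ from a feasible solution to (B), satisfy $$P^{\{0\}}+(P^{\{0\}})^\top\succ0\quad\text{and}\quad T_k(w^{\{0\}},P^{\{0\}},r^{\{0\}})\succ0\ \text{ for all }k\in\{1,\dots,K\}.$$
   Context: Notation. $[\,\cdot\,]_i$ denotes components; $\mathrm{vec}$ is column-stacking vectorization, $\mathrm{vech}$ the half-vectorization (stacking the on-and-below-diagonal parts of the columns of a symmetric matrix), $\otimes$ the Kronecker product, $I_n$ the identity. The index $k$ ranges over $\{1,\dots,K\}$. Dynamics. The system is $\dot x=f(x,\theta)+G(x,\theta)u(x)$ with parameter $\theta\in\mathbb{S}_\theta\subseteq\mathbb{R}^{d_\theta}$. Polytopic dynamics: there are a positive integer $K$, continuous $h_k:\mathbb{S}_\theta\to[0,1]$ with $\sum_{k=1}^Kh_k(\theta)=1$, and locally Lipschitz $f_k:\mathbb{R}^{d_x}\to\mathbb{R}^{d_x}$ with $f_k(0)=0$ and $G_k:\mathbb{R}^{d_x}\to\mathbb{R}^{d_x\times d_u}$, with $f(x,\theta)=\sum_kh_k(\theta)f_k(x)$, $G(x,\theta)=\sum_kh_k(\theta)G_k(x)$. Monomial bases. A function of $x\in\mathbb{R}^{d_x}$ (vector or matrix valued) is a monomial basis if each component is a primitive monomial $\prod_{i=1}^{d_x}[x]_i^{[a]_i}$ with $a\in\{0,1,2,\dots\}^{d_x}$. It is strict if it vanishes exactly at $x=0$. The non-redundant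 form of a monomial basis is a monomial basis whose components consist of those of the original one and are pairwise distinct monomials. Let $z:\mathbb{R}^{d_x}\to\mathbb{R}^{d_z}$ and $\zeta:\mathbb{R}^{d_x}\to\mathbb{R}^{d_\zeta}$ be monomial bases with $z$ strict and $[\zeta(x)]_1=1$; let $\xi:\mathbb{R}^{d_x}\to\mathbb{R}^{d_\xi}$ be the non-redundant form of $\zeta(x)\otimes z(x)$; let $Z:\mathbb{R}^{d_x}\to\mathbb{R}^{d_u\times d_Z}$ be continuous with $G_k(x)Z(x)$ polynomial for each $k$. SOS settings. (i) For each $k$ there is a known polynomial matrix $F_k:\mathbb{R}^{d_x}\to\mathbb{R}^{d_x\times d_z}$ with $f_k(x)=F_k(x)z(x)$. (ii) The controller is $\hat u(x,w)=\Phi(x)^\top w$ with $\Phi(x)=z(x)\otimes Z(x)^\top$ locally Lipschitz and $w\in\mathbb{R}^{d_w}$, $d_w=d_zd_Z$. (iii) For any $P\in\mathbb{R}^{d_z\times d_z}$, $w\in\mathbb{R}^{d_w}$ and $k$, each component of $$U_k(x,P,w):=-\frac{P+P^\top}{2}\,\frac{\partial z(x)}{\partial x^\top}\Big(F_k(x)+G_k(x)Z(x)\,\mathrm{vec}^{-1}_{d_Z,d_z}(w)\Big)$$ is a linear combination (constant coefficients) of the components of $\zeta(x)\otimes\zeta(x)$, where $\mathrm{vec}^{-1}_{d_Z,d_z}(w)\in\mathbb{R}^{d_Z\times d_z}$ is the matrix whose vectorization is $w$. (iv) There exist a symmetric $P\succ0$ and $w\in\mathbb{R}^{d_w}$ such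 that for every $k$ there is a symmetric $\bar S_k\succ0$ with $U_k(x,P,w)+U_k(x,P,w)^\top=(\zeta(x)\otimes I_{d_z})^\top\bar S_k(\zeta(x)\otimes I_{d_z})$ for all $x$. The matrices $T_k$. Write $r=[r_1,\dots,r_K]\in\mathbb{R}^{d_r\times K}$ with $r_k\in\mathbb{R}^{d_r}$. Given constants $C_r\in\mathbb{R}^{d_r\times d_\xi(d_\xi+1)/2}$ and $c_r\in\{0,1\}$ for which the following system has a unique solution for every $k$ and every $(w,P,r)$ (the constants $C_r,c_r$ are always meant to have this property), $T_k(w,P,r)\in\mathbb{R}^{d_\xi\times d_\xi}$ is the unique $T_k$ satisfying $$\xi(x)^\top T_k\,\xi(x)=z(x)^\top U_k(x,P,w)z(x)\ \ \forall x\in\mathbb{R}^{d_x},\qquad C_r\,\mathrm{vech}(T_k)=c_rr_k,\qquad T_k=T_k^\top.$$ *)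

(* Defs.v *)
From HB Require Import structures.
From mathcomp Require Import all_boot all_order all_algebra.
From mathcomp Require Import all_classical all_reals all_analysis.
From mathcomp Require mpoly.
From mathcomp Require Import mxtens.

Set Implicit Arguments.
Unset Strict Implicit.
Unset Printing Implicit Defensive.

Import Order.TTheory GRing.Theory Num.Theory.
Import numFieldNormedType.Exports.

Local Open Scope classical_set_scope.
Local Open Scope ring_scope.

Section MatrixNotions.
Variable R : realType.

Definition posdefmx n (A : 'M[R]_n) : Prop :=
  A^T = A /\ forall v : 'cV[R]_n, v != 0 -> 0 < (v^T *m A *m v) 0 0.

Definition possemidefmx n (A : 'M[R]_n) : Prop :=
  A^T = A /\ forall v : 'cV[R]_n, 0 <= (v^T *m A *m v) 0 0.

(* The Loewner order: [loewner_ge A B] is A ⪰ B. *)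
Definition loewner_ge n (A B : 'M[R]_n) : Prop := possemidefmx (A - B).

(* The Kronecker product of a column vector with a matrix; the cast only
   identifies the number of columns 1 * q with q. *)
Definition kron m p q (v : 'cV[R]_m) (B : 'M[R]_(p, q)) : 'M[R]_(m * p, q) :=
  castmx (erefl, mul1n q) (v *t B).

(* [mxvec] is row-major and returns a row vector, hence the two transpositions
   to obtain the column-stacking vectorization. *)
Definition vec m n (A : 'M[R]_(m, n)) : 'cV[R]_(n * m) := (mxvec A^T)^T.

Definition unvec m n (w : 'cV[R]_(n * m)) : 'M[R]_(m, n) := (vec_mx w^T)^T.

Lemma vecK m n : cancel (@vec m n) (@unvec m n).
Proof. by move=> A; rewrite /unvec /vec trmxK mxvecK trmxK. Qed.

Lemma unvecK m n : cancel (@unvec m n) (@vec m n).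
Proof. by move=> w; rewrite /unvec /vec trmxK vec_mxK trmxK. Qed.

(* Positions (i, j) with j <= i, column after column. *)
Definition vech_index n : seq ('I_n * 'I_n) :=
  [seq (i, j) | j : 'I_n <- enum 'I_n,
                i : 'I_n <- [seq i : 'I_n <- enum 'I_n | (j <= i)%N]].

Lemma size_vech_index n : size (vech_index n) = ((n * n.+1)./2)%N.
Proof.
rewrite size_allpairs_dep sumnE big_map big_enum /=.
rewrite (eq_bigr (fun j : 'I_n => (n - j)%N)) => [|j _]; last first.
  rewrite -(size_map val) -(filter_map val (leq j)) val_enum_ord size_filter.
  rewrite -[X in iota 0 X](subnKC (ltnW (ltn_ord j))) iotaD count_cat.
  have /eqP -> : count (leq j) (iota 0 j) == 0.
    by rewrite -leqn0 leqNgt -has_count; apply/hasPn => i; rewrite mem_iota -ltnNge.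
  have /eqP -> : count (leq j) (iota (0 + j)%N (n - j)%N) == (n - j)%N.
    rewrite -[X in _ == X](size_iota (0 + j)%N) -all_count.
    by apply/allP => i; rewrite mem_iota => /andP[].
  by [].
rewrite (reindex_inj rev_ord_inj) /= (eq_bigr (fun j : 'I_n => j.+1)) => [|j _].
  rewrite -(big_mkord predT succn) -[LHS]add0n -(big_nat_recl _ _ id) //.
  by rewrite bin2_sum bin2 mulnC.
by rewrite subKn.
Qed.

Definition vech n (A : 'M[R]_n) : 'cV[R]_((n * n.+1)./2) :=
  \col_p nth 0 [seq A ij.1 ij.2 | ij <- vech_index n] p.

End MatrixNotions.

Section Functions.
Variables (R : realType) (d : nat).

Definition monomial (a : 'I_d -> nat) (x : 'cV[R]_d) : R :=
  \prod_(i < d) x i 0 ^+ a i.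

Definition monomial_basis m n (g : 'cV[R]_d -> 'M[R]_(m, n)) : Prop :=
  forall i j, exists a : 'I_d -> nat, forall x, g x i j = monomial a x.

Definition strict_basis m n (g : 'cV[R]_d -> 'M[R]_(m, n)) : Prop :=
  forall x, g x = 0 <-> x = 0.

Definition nonredundant_form m n
    (g : 'cV[R]_d -> 'cV[R]_m) (xi : 'cV[R]_d -> 'cV[R]_n) : Prop :=
  [/\ monomial_basis xi,
      forall i, exists j, forall x, xi x i 0 = g x j 0,
      forall j, exists i, forall x, xi x i 0 = g x j 0
    & forall i i', (forall x, xi x i 0 = xi x i' 0) -> i = i'].

Definition polynomial_mx m n (g : 'cV[R]_d -> 'M[R]_(m, n)) : Prop :=
  forall i j, exists p : mpoly.mpoly d R,
    forall x, g x i j = mpoly.meval (fun l => x l 0) p.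

Definition locally_lipschitz m n (g : 'cV[R]_d -> 'M[R]_(m, n)) : Prop :=
  [locally [lipschitz g x | x in [set: 'cV[R]_d]]].

(* The matrix of partial derivatives, with rows indexed by the components
   of g. The library's Jacobian acts on row vectors and is its transpose. *)
Definition jac m (g : 'cV[R]_d -> 'cV[R]_m) (x : 'cV[R]_d) : 'M[R]_(m, d) :=
  \matrix_(i < m, j < d) 'D_(delta_mx j 0) (fun y => g y i 0 : R) x.

End Functions.

Section Setting.
Variables (R : realType) (dx du dz dZ dzeta dxi K : nat).

Record polytopic dtheta (Stheta : set 'cV[R]_dtheta)
    (f : 'cV[R]_dx -> 'cV[R]_dtheta -> 'cV[R]_dx)
    (G : 'cV[R]_dx -> 'cV[R]_dtheta -> 'M[R]_(dx, du))
    (h : 'I_K -> 'cV[R]_dtheta -> R)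
    (fk : 'I_K -> 'cV[R]_dx -> 'cV[R]_dx)
    (Gk : 'I_K -> 'cV[R]_dx -> 'M[R]_(dx, du)) : Prop := Polytopic {
  polytopic_card : (0 < K)%N ;
  polytopic_cont : forall k, {within Stheta, continuous (h k)} ;
  polytopic_itv : forall k theta, Stheta theta -> 0 <= h k theta <= 1 ;
  polytopic_sum : forall theta, Stheta theta -> \sum_(k < K) h k theta = 1 ;
  polytopic_lip : forall k, locally_lipschitz (fk k) ;
  polytopic_f0 : forall k, fk k 0 = 0 ;
  polytopic_f : forall x theta, Stheta theta ->
    f x theta = \sum_(k < K) h k theta *: fk k x ;
  polytopic_G : forall x theta, Stheta theta ->
    G x theta = \sum_(k < K) h k theta *: Gk k x }.

Variables (z : 'cV[R]_dx -> 'cV[R]_dz) (zeta : 'cV[R]_dx -> 'cV[R]_dzeta).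
Variables (xi : 'cV[R]_dx -> 'cV[R]_dxi) (Z : 'cV[R]_dx -> 'M[R]_(du, dZ)).
Variables (F : 'I_K -> 'cV[R]_dx -> 'M[R]_(dx, dz)).
Variables (G : 'I_K -> 'cV[R]_dx -> 'M[R]_(dx, du)).

Record bases (dzeta_gt0 : (0 < dzeta)%N) : Prop := Bases {
  bases_z : monomial_basis z ;
  bases_z_strict : strict_basis z ;
  bases_zeta : monomial_basis zeta ;
  bases_zeta1 : forall x, zeta x (Ordinal dzeta_gt0) 0 = 1 ;
  bases_xi : nonredundant_form (fun x => kron (zeta x) (z x)) xi ;
  bases_Z_cont : continuous Z ;
  bases_GZ : forall k, polynomial_mx (fun x => G k x *m Z x) }.

Definition Phi (x : 'cV[R]_dx) : 'M[R]_(dz * dZ, du) := kron (z x) (Z x)^T.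

Definition U (k : 'I_K) (x : 'cV[R]_dx) (P : 'M[R]_dz) (w : 'cV[R]_(dz * dZ)) :
    'M[R]_dz :=
  - (2^-1 *: (P + P^T) *m jac z x *m (F k x + G k x *m Z x *m unvec w)).

Definition Y (k : 'I_K) (x : 'cV[R]_dx) (Q : 'M[R]_dz) (H : 'M[R]_(dZ, dz)) :
    'M[R]_dz :=
  - (jac z x *m (F k x *m Q + G k x *m Z x *m H)).

Definition zetaI (x : 'cV[R]_dx) : 'M[R]_(dzeta * dz, dz) :=
  kron (zeta x) 1%:M.

Record sos_settings (fk : 'I_K -> 'cV[R]_dx -> 'cV[R]_dx)
    (uhat : 'cV[R]_dx -> 'cV[R]_(dz * dZ) -> 'cV[R]_du) : Prop := SosSettings {
  sos_F_poly : forall k, polynomial_mx (F k) ;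
  sos_F : forall k x, fk k x = F k x *m z x ;
  sos_uhat : forall x w, uhat x w = (Phi x)^T *m w ;
  sos_Phi_lip : locally_lipschitz Phi ;
  sos_U_span : forall P w k i j, exists c : 'I_(dzeta * dzeta) -> R,
    forall x, U k x P w i j = \sum_l c l * kron (zeta x) (zeta x) l 0 ;
  sos_init : exists (P : 'M[R]_dz) (w : 'cV[R]_(dz * dZ)), posdefmx P /\
    forall k, exists Sbar : 'M[R]_(dzeta * dz), posdefmx Sbar /\
    forall x, U k x P w + (U k x P w)^T = (zetaI x)^T *m Sbar *m zetaI x }.

Definition T_system dr (Cr : 'M[R]_(dr, (dxi * dxi.+1)./2)) (cr : bool)
    (k : 'I_K) (w : 'cV[R]_(dz * dZ)) (P : 'M[R]_dz) (r : 'M[R]_(dr, K))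
    (T : 'M[R]_dxi) : Prop :=
  [/\ forall x, (xi x)^T *m T *m xi x = (z x)^T *m U k x P w *m z x,
      Cr *m vech T = cr%:R *: col k r
    & T = T^T].

Definition T_wellposed dr (Cr : 'M[R]_(dr, (dxi * dxi.+1)./2)) (cr : bool) :
    Prop :=
  forall k w P r, exists! T, T_system Cr cr k w P r T.

(* The unique solution; the default value 0 is irrelevant under
   [T_wellposed]. *)
Definition Tmx dr (Cr : 'M[R]_(dr, (dxi * dxi.+1)./2)) (cr : bool)
    (k : 'I_K) (w : 'cV[R]_(dz * dZ)) (P : 'M[R]_dz) (r : 'M[R]_(dr, K)) :
    'M[R]_dxi :=
  xget 0 [set T | T_system Cr cr k w P r T].

Definition feasibleA (Q : 'M[R]_dz) (H : 'M[R]_(dZ, dz))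
    (S : 'I_K -> 'M[R]_(dzeta * dz)) (eps1 : R) : Prop :=
  [/\ forall k x,
        Y k x Q H + (Y k x Q H)^T = (zetaI x)^T *m S k *m zetaI x,
      forall k, S k = (S k)^T /\ loewner_ge (S k) eps1%:M,
      Q = Q^T /\ loewner_ge Q eps1%:M
    & 0 < eps1].

Definition feasibleB dr (Cr : 'M[R]_(dr, (dxi * dxi.+1)./2)) (cr : bool)
    (w0 : 'cV[R]_(dz * dZ)) (P0 : 'M[R]_dz) (r : 'M[R]_(dr, K)) (eps2 : R) :
    Prop :=
  (forall k, loewner_ge (Tmx Cr cr k w0 P0 r) eps2%:M) /\ 0 < eps2.

End Setting.

(* Main.v *)
Require Import Defs.
From HB Require Import structures.
From mathcomp Require Import all_boot all_order all_algebra.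
From mathcomp Require Import all_classical all_reals all_analysis.
From mathcomp Require Import mxtens ring lra.

(** Problem (A) is the hypothesis on [U_k] after the change of variables
    [Q = P^-1], [H = W Q], where [w = vec W]. For symmetric invertible [P] one
    has [U_k(x, P, w) = P Y_k(x, Q, H) P] ([U_Y_congr]), and a congruence by a
    constant matrix acts on Gram matrices over [zeta] tensor [I] as the
    congruence by [I] tensor that matrix ([zetaI_congr]), so positive
    definiteness is carried both ways. A positive definite matrix dominates a
    positive multiple of the identity ([posdefmx_loewner_ge]), and there are
    finitely many of them, which gives the common margin [epsilon_1].

    Going back from a solution of (A) to [P = Q^-1], the form [z^T U_k z] has a
    positive definite Gram matrix in the redundant basis [zeta] tensor [z].
    This basis is [M xi] with [M] injective ([nonredundant_factor]), so the
    form has a positive definite Gram matrix in [xi] as well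
    ([feasibleA_posdef_gram]). What is left is to make [T_k] equal to that
    matrix by the choice of [r]. The symmetric Gram matrices of a given form
    are a translate of a subspace that depends on [xi] only, so a linear gauge
    condition that is met exactly once in each translate, for every right-hand
    side, makes the system for [T_k] uniquely solvable for all data
    ([gauge_fixing], [T_wellposed_exists]), and taking for [r_k] the gauge value
    of the desired matrix selects it. The
    margin of these matrices is [epsilon_2].

    In the other direction, domination of a positive multiple of the identity
    implies positive definiteness, which is the last part. *)

Set Implicit Arguments.
Unset Strict Implicit.
Unset Printing Implicit Defensive.

Import Order.TTheory GRing.Theory Num.Theory.
Import numFieldNormedType.Exports.

Local Open Scope classical_set_scope.
Local Open Scope ring_scope.

(** * Positive definite matrices and their margins in the Loewner order *)

Lemma posdefmx_ge0 (R : realType) n (A : 'M[R]_n) (v : 'cV[R]_n) :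
  posdefmx A -> 0 <= (v^T *m A *m v) 0 0.
Proof.
move=> [_ A_gt0]; have [->|/A_gt0/ltW//] := eqVneq v 0.
by rewrite mulmx0 mxE.
Qed.

Lemma posdefmx_unit (R : realType) n (A : 'M[R]_n) : posdefmx A -> A \in unitmx.
Proof.
move=> [_ A_gt0]; rewrite -row_free_unit -kermx_eq0; apply/rowV0P => v.
move=> /sub_kermxP vA0; apply/eqP; rewrite -trmx_eq0; apply/negP => /negP.
by move=> /A_gt0; rewrite trmxK vA0 mul0mx mxE ltxx.
Qed.

Lemma posdefmx_congr (R : realType) m n (A : 'M[R]_m) (M : 'M[R]_(m, n)) :
  (forall v : 'cV_n, M *m v = 0 -> v = 0) ->
  posdefmx A -> posdefmx (M^T *m A *m M).
Proof.
move=> M_inj [A_sym A_gt0]; split=> [|v v_neq0].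
  by rewrite !trmx_mul trmxK A_sym mulmxA.
rewrite !mulmxA -trmx_mul -mulmxA; apply: A_gt0.
by apply: contra_neq v_neq0; apply: M_inj.
Qed.

Lemma posdefmx_inv (R : realType) n (A : 'M[R]_n) :
  posdefmx A -> posdefmx (invmx A).
Proof.
move=> A_pos; have A_unit := posdefmx_unit A_pos.
have -> : invmx A = (invmx A)^T *m A *m invmx A.
  by rewrite trmx_inv (proj1 A_pos) mulVmx // mul1mx.
apply: posdefmx_congr => // v Av0.
by rewrite -[v](mulKVmx A_unit) Av0 mulmx0.
Qed.

Lemma posdefmx_scale (R : realType) n (c : R) (A : 'M[R]_n) :
  0 < c -> posdefmx A -> posdefmx (c *: A).
Proof.
move=> c_gt0 [A_sym A_gt0]; split=> [|v v_neq0]; first by rewrite linearZ /= A_sym.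
by rewrite -scalemxAr -scalemxAl mxE mulr_gt0 ?A_gt0.
Qed.

Lemma colvec_sqr (R : realType) n (v : 'cV[R]_n) :
  (v^T *m v) 0 0 = \sum_i v i 0 ^+ 2.
Proof. by rewrite mxE; apply: eq_bigr => i _; rewrite mxE expr2. Qed.

Lemma colvec_sqr_gt0 (R : realType) n (v : 'cV[R]_n) :
  v != 0 -> 0 < (v^T *m v) 0 0.
Proof.
move=> v_neq0; rewrite colvec_sqr lt0r sumr_ge0 ?andbT; last first.
  by move=> i _; rewrite sqr_ge0.
apply: contra_neq v_neq0 => /eqP; rewrite psumr_eq0 => [/allP v0|i _]; last first.
  by rewrite sqr_ge0.
apply/colP => i; rewrite mxE; apply/eqP.
by rewrite -sqrf_eq0 (implyP (v0 i _)) ?mem_index_enum.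
Qed.

Lemma loewner_geP (R : realType) n (A : 'M[R]_n) (e : R) :
  loewner_ge A e%:M <->
  A^T = A /\ forall v : 'cV_n, e * (v^T *m v) 0 0 <= (v^T *m A *m v) 0 0.
Proof.
have symE : ((A - e%:M)^T = A - e%:M) <-> (A^T = A).
  by rewrite linearB /= tr_scalar_mx; split=> [/addIr|->].
have formE (v : 'cV_n) : (v^T *m (A - e%:M) *m v) 0 0 =
    (v^T *m A *m v) 0 0 - e * (v^T *m v) 0 0.
  by rewrite mulmxBr mulmxBl mul_mx_scalar -scalemxAl mxE [in X in _ + X]mxE
    [in X in _ - X]mxE.
split=> -[/symE A_sym le_eA]; split=> // v; move: (le_eA v).
  by rewrite formE subr_ge0.
by rewrite formE subr_ge0.
Qed.

Lemma loewner_ge_posdef (R : realType) n (A : 'M[R]_n) (e : R) :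
  0 < e -> loewner_ge A e%:M -> posdefmx A.
Proof.
move=> e_gt0 /loewner_geP[A_sym le_eA]; split=> // v v_neq0.
by apply: lt_le_trans (le_eA v); rewrite mulr_gt0 ?colvec_sqr_gt0.
Qed.

(** Cauchy-Schwarz for the inner product of [A], applied to [v] and to
    [u = A^-1 e_i]: the product of [u] with [v] is [v_i] and that of [u] with
    itself is the [i]-th diagonal entry of [A^-1]. *)
Lemma posdefmx_coord_le (R : realType) n (A : 'M[R]_n) (v : 'cV[R]_n) i :
  posdefmx A -> v i 0 ^+ 2 <= invmx A i i * (v^T *m A *m v) 0 0.
Proof.
move=> A_pos; have A_unit := posdefmx_unit A_pos.
have A_sym := proj1 A_pos.
pose u := invmx A *m (delta_mx i 0 : 'cV_n).
have Au : A *m u = delta_mx i 0 by rewrite mulKVmx.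
have uA : u^T *m A = delta_mx 0 i by rewrite -A_sym -trmx_mul Au trmx_delta.
have u_i : u i 0 = invmx A i i by rewrite /u -colE mxE.
have b_gt0 : 0 < invmx A i i.
  have := (posdefmx_inv A_pos).2 (delta_mx i 0).
  rewrite trmx_delta -rowE -colE !mxE; apply.
  by apply/eqP => /matrixP/(_ i 0); rewrite !mxE !eqxx => /eqP; rewrite oner_eq0.
have vAu : (v^T *m A *m u) 0 0 = v i 0 by rewrite -mulmxA Au -colE !mxE.
have uAv : (u^T *m A *m v) 0 0 = v i 0 by rewrite uA -rowE !mxE.
have uAu : (u^T *m A *m u) 0 0 = invmx A i i by rewrite uA -rowE [LHS]mxE u_i.
(* The form is nonnegative at the multiple of the residual of v along u. *)
have := posdefmx_ge0 (invmx A i i *: v - v i 0 *: u) A_pos.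
rewrite [_^T]linearB /= ![(_ *: _)^T]linearZ /=.
rewrite !(mulmxBl, mulmxBr) -!scalemxAl -!scalemxAr.
move: vAu uAv uAu; set p := v^T *m A *m u; set q := u^T *m A *m v.
set r := u^T *m A *m u; set s := v^T *m A *m v.
rewrite -!/p -!/q -!/r -!/s.
have E (M N : 'M[R]_1) : (M - N) 0 0 = M 0 0 - N 0 0 by rewrite !mxE.
have Es c (M : 'M[R]_1) : (c *: M) 0 0 = c * M 0 0 by rewrite !mxE.
rewrite !(E, Es) => -> -> ->; move: (v i 0) (s 0 0) => t a ge0.
rewrite -(ler_pM2l b_gt0) -subr_ge0; lra.
Qed.

(** Summing the bounds on the coordinates gives [v^T v <= tr(A^-1) v^T A v], so
    the inverse of any positive upper bound of the trace of [A^-1] is a valid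
    margin. No compactness of the unit sphere is involved. The bound in the
    proof has absolute values and a summand [1] so that its positivity is
    immediate, in dimension 0 as well. *)
Lemma posdefmx_loewner_ge (R : realType) n (A : 'M[R]_n) :
  posdefmx A -> exists2 e, 0 < e & loewner_ge A e%:M.
Proof.
move=> A_pos; pose c := 1 + \sum_i `|invmx A i i|.
have c_gt0 : 0 < c by rewrite ltr_wpDr // sumr_ge0.
exists c^-1; first by rewrite invr_gt0.
apply/loewner_geP; split=> [|v]; first by case: A_pos.
rewrite mulrC ler_pdivrMr // mulrC mulrDl mul1r colvec_sqr mulr_suml.
apply: ler_wpDl; first exact: posdefmx_ge0.
apply: ler_sum => i _; apply: le_trans (posdefmx_coord_le _ _ A_pos) _.
by rewrite ler_wpM2r ?posdefmx_ge0 // ler_norm.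
Qed.

Lemma loewner_ge_le (R : realType) n (A : 'M[R]_n) (a b : R) :
  a <= b -> loewner_ge A b%:M -> loewner_ge A a%:M.
Proof.
move=> le_ab /loewner_geP[A_sym ge_b]; apply/loewner_geP; split=> // v.
by apply: le_trans (ge_b v); rewrite ler_wpM2r // colvec_sqr sumr_ge0 // => i _;
  rewrite sqr_ge0.
Qed.

Lemma posdefmx_loewner_ge_fin (R : realType) (I : finType) n
    (A : I -> 'M[R]_n) :
  (forall i, posdefmx (A i)) ->
  exists2 e, 0 < e & forall i, loewner_ge (A i) e%:M.
Proof.
move=> A_pos.
have e_ex i : exists e, 0 < e /\ loewner_ge (A i) e%:M.
  by have [e e_gt0 ge_e] := posdefmx_loewner_ge (A_pos i); exists e.
have [e /all_and2[e_gt0 ge_e]] := fin_all_exists e_ex.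
exists (\big[Num.min/1]_i e i) => [|i]; first by apply: lt_bigmin.
by apply: loewner_ge_le (ge_e i); apply: bigmin_le.
Qed.

(** * Gram matrices of a quadratic form up to a gauge condition *)

(** A subspace given by an arbitrary, possibly infinite, family of linear
    conditions still has a basis: among the matrices whose row space lies in
    it, one of maximal rank spans it, since any missing vector could be added
    to its rows. *)
Lemma linear_closed_row_space (F : fieldType) m (W : 'rV[F]_m -> Prop) :
  W 0 -> (forall a u v, W u -> W v -> W (a *: u + v)) ->
  exists n (N : 'M[F]_(n, m)), row_free N /\ forall v, W v <-> (v <= N)%MS.
Proof.
move=> W0 W_lin.
pose inner (N : 'M[F]_m) := forall v : 'rV_m, (v <= N)%MS -> W v.
pose P r := `[< exists N, inner N /\ \rank N = r >].
have P0 : exists r, P r.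
  exists 0%N; apply/asboolP; exists 0; rewrite mxrank0; split=> // v.
  by rewrite submx0 => /eqP ->.
have P_le r : P r -> (r <= m)%N by move=> /asboolP[N [_ <-]]; exact: rank_leq_row.
case: (ex_maxnP P0 P_le) => r /asboolP[N [N_in rN]] r_max.
exists (\rank N), (row_base N); rewrite row_base_free; split=> // v.
rewrite eq_row_base; split=> [Wv|/N_in//].
apply/negPn/negP => vN.
have : (\rank (N + v)%MS <= r)%N.
  apply/r_max/asboolP; exists (N + v)%MS; split=> // u /sub_addsmxP[[a b] /= ->].
  rewrite [b]mx11_scalar mul_scalar_mx addrC.
  by apply: W_lin => //; apply: N_in; apply: submxMl.
rewrite -rN leqNgt => /negP; apply; apply: rank_ltmx.
by rewrite ltmxE addsmxSl /= addsmx_sub submx_refl.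
Qed.

(** Every position on or below the diagonal is listed by [vech_index], and
    symmetry recovers the entries above it. *)
Lemma vech_sym_inj (R : realType) n (A B : 'M[R]_n) :
  A^T = A -> B^T = B -> vech A = vech B -> A = B.
Proof.
move=> A_sym B_sym /matrixP vAB.
have low (i j : 'I_n) : (j <= i)%N -> A i j = B i j.
  move=> le_ji; have ijV : (i, j) \in vech_index n.
    apply/allpairsPdep; exists j, i; split=> //; first by rewrite mem_enum.
    by rewrite mem_filter le_ji mem_enum.
  have idxV : (index (i, j) (vech_index n) < (n * n.+1)./2)%N.
    by rewrite -size_vech_index index_mem.
  have := vAB (Ordinal idxV) 0; rewrite !mxE /=.
  by rewrite !(nth_map (i, j)) ?index_mem // nth_index.
apply/matrixP => i j; have [/low//|/ltnW/low] := leqP j i.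
by rewrite -{2}A_sym -{2}B_sym !mxE.
Qed.

Lemma vech_linear (R : realType) n (a : R) (A B : 'M[R]_n) :
  vech (a *: A + B) = a *: vech A + vech B.
Proof.
apply/colP => p; rewrite !mxE.
have p_lt : (p < size (vech_index n))%N by rewrite size_vech_index.
case: n p A B p_lt => [|n] p A B p_lt; first by case: p p_lt.
by rewrite !(nth_map (ord0, ord0)) // !mxE.
Qed.

Lemma vech0 (R : realType) n : vech (0 : 'M[R]_n) = 0.
Proof.
by have := vech_linear (-1) (0 : 'M[R]_n) 0; rewrite scaler0 addr0 scaleN1r addNr.
Qed.

(** The Gram matrix of a quadratic form in [xi x] is in general not unique,
    because the products of components of [xi] may satisfy relations such as
    [x^2 * 1 = x * x]. The
    symmetric matrices of the zero form are a subspace, and a linear gauge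
    condition selects one Gram matrix when it restricts to a bijection from
    that subspace to the space of values of the gauge. If the half-vectors of
    the subspace are the span of the independent rows of [N], the transpose of
    a right inverse of [N] is such a condition, with [cr = 1]. If the subspace
    is trivial there is nothing to fix, but the gauge must have at least one
    row: the zero row with [cr = 0] serves. The last clause says that in both
    cases any symmetric matrix is selected by a suitable right-hand side,
    namely by its own gauge value. *)
Lemma gauge_fixing (R : realType) (X : Type) n (xi : X -> 'cV[R]_n) :
  exists (dr : nat) (Cr : 'M[R]_(dr, (n * n.+1)./2)) (cr : bool),
  [/\ (0 < dr)%N,
      forall T0 : 'M[R]_n, T0^T = T0 -> forall c : 'cV[R]_dr,
      exists! T : 'M[R]_n,
        [/\ forall x, (xi x)^T *m T *m xi x = (xi x)^T *m T0 *m xi x,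
            Cr *m vech T = cr%:R *: c & T = T^T]
    & forall v : 'cV[R]_((n * n.+1)./2), Cr *m v = cr%:R *: (Cr *m v)].
Proof.
pose null (T : 'M[R]_n) := T^T = T /\ forall x, (xi x)^T *m T *m xi x = 0.
have null_lin a S T : null S -> null T -> null (a *: S + T).
  move=> [S_sym S0] [T_sym T0]; split=> [|x].
    by rewrite linearD linearZ /= S_sym T_sym.
  by rewrite mulmxDr mulmxDl -scalemxAr -scalemxAl S0 T0 scaler0 addr0.
have null0 : null 0 by split=> [|x]; rewrite ?trmx0 // mulmx0 mul0mx.
have [|a u v [S S_null uE] [T T_null vE]|d [N [N_free NP]]] :=
    @linear_closed_row_space _ _ (fun v => exists2 T, null T & v = (vech T)^T).
- by exists 0 => //; rewrite vech0 trmx0.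
- exists (a *: S + T); first exact: null_lin.
  by rewrite vech_linear linearD linearZ /= uE vE.
have null_inj T : null T -> vech T = 0 -> T = 0.
  move=> [T_sym _] vT0; apply: vech_sym_inj; rewrite ?trmx0 //.
  by rewrite vT0 vech0.
(* It remains to find Cr and cr for which the gauge is injective on the null
   matrices and reaches every right-hand side from every starting point. *)
suff [dr [Cr [cr [dr_gt0 Cr_inj Cr_surj Cr_im]]]] :
    exists (dr : nat) (Cr : 'M[R]_(dr, (n * n.+1)./2)) (cr : bool),
    [/\ (0 < dr)%N, forall T, null T -> Cr *m vech T = 0 -> T = 0,
      forall u (c : 'cV[R]_dr), exists2 S, null S & Cr *m (vech S + u) = cr%:R *: c
    & forall v : 'cV[R]_((n * n.+1)./2), Cr *m v = cr%:R *: (Cr *m v)].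
  exists dr, Cr, cr; split=> // T0 T0_sym c.
  have [S [S_sym S0] CrS] := Cr_surj (vech T0) c.
  exists (S + T0); split; [split=> [x||]|].
  - by rewrite mulmxDr mulmxDl S0 add0r.
  - by rewrite -[S]scale1r vech_linear scale1r.
  - by rewrite linearD /= S_sym T0_sym.
  move=> T [T_T0 CrT T_sym].
  have diff_null : null (- 1 *: (S + T0) + T).
    split=> [|x]; first by rewrite linearD linearZ linearD /= S_sym T0_sym -T_sym.
    rewrite mulmxDr mulmxDl -scalemxAr -scalemxAl mulmxDr mulmxDl S0 add0r T_T0.
    by rewrite scaleN1r addNr.
  apply/esym/eqP; rewrite -subr_eq0 addrC -scaleN1r; apply/eqP.
  apply: Cr_inj => //; rewrite vech_linear -[S]scale1r vech_linear scale1r.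
  by rewrite mulmxDr -scalemxAr CrS CrT scaleN1r addNr.
have [d0|d_gt0] := posnP d.
  exists 1%N, 0, false; split=> // [T T_null _|u c|v].
  - apply: null_inj => //; apply/eqP; rewrite -trmx_eq0.
    have /NP/submxP[a ->] : exists2 S, null S & (vech T)^T = (vech S)^T by exists T.
    suff -> : a = 0 by rewrite mul0mx.
    by apply/rowP => i; have := ltn_ord i; rewrite {2}d0.
  - by exists 0 => //; rewrite mul0mx scale0r.
  - by rewrite mul0mx scale0r.
have NC : N *m pinvmx N = 1%:M by apply: mulmxVp.
exists d, (pinvmx N)^T, true; split=> // [T T_null|u c|v].
- have /NP/submxP[a vT] : exists2 S, null S & (vech T)^T = (vech S)^T by exists T.
  rewrite -[vech T]trmxK vT -trmx_mul -mulmxA NC mulmx1 => a0.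
  by apply: null_inj => //; rewrite -[vech T]trmxK vT -(trmxK a) a0 trmx0 mul0mx trmx0.
- have /NP[S S_null vS] : ((c - (pinvmx N)^T *m u)^T *m N <= N)%MS by apply: submxMl.
  exists S => //; rewrite mulmxDr -[vech S]trmxK -vS -trmx_mul -mulmxA NC mulmx1.
  by rewrite trmxK subrK scale1r.
- by rewrite scale1r.
Qed.

(** * Kronecker products and Gram representations *)

Lemma kronE (R : realType) m p q (v : 'cV[R]_m) (B : 'M[R]_(p, q)) i j k :
  kron v B (mxtens_index (i, j)) k = v i 0 * B j k.
Proof.
rewrite /kron castmxE /= mxE cast_ord_id mxtens_indexK /=.
congr (v _ _ * B _ _); apply/val_inj => //=; last by rewrite modn_small.
by rewrite divn_small.
Qed.

Lemma sum_mxtens (R : realType) m n (f : 'I_(m * n) -> R) :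
  \sum_k f k = \sum_i \sum_j f (mxtens_index (i, j)).
Proof.
rewrite pair_big /= (reindex (@mxtens_index m n)) /=.
  by apply: eq_bigr => -[].
by exists (@mxtens_unindex m n) => k _; rewrite (mxtens_indexK, mxtens_unindexK).
Qed.

Lemma kron_mulmx (R : realType) m p q r (v : 'cV[R]_m) (A : 'M[R]_(p, q))
    (B : 'M[R]_(q, r)) :
  kron v A *m B = kron v (A *m B).
Proof.
apply/matrixP => i k; case: (mxtens_indexP i) => a b; rewrite mxE kronE mxE.
by rewrite mulr_sumr; apply: eq_bigr => l _; rewrite kronE mulrA.
Qed.

Lemma tens1_kron (R : realType) m p q r (v : 'cV[R]_m) (A : 'M[R]_(p, q))
    (B : 'M[R]_(q, r)) :
  (1%:M *t A) *m kron v B = kron v (A *m B).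
Proof.
apply/matrixP => i k; case: (mxtens_indexP i) => a b; rewrite mxE kronE mxE.
rewrite sum_mxtens (bigD1 a) //= [X in _ + X]big1 ?addr0 => [|c /negPf ca].
  rewrite mulr_sumr; apply: eq_bigr => l _; rewrite tensmxE kronE !mxE eqxx mul1r.
  by rewrite mulrCA.
by apply: big1 => l _; rewrite tensmxE mxE eq_sym ca !mul0r.
Qed.

Lemma tens1_unit_inj (R : realType) m n (A : 'M[R]_n) (v : 'cV[R]_(m * n)) :
  A \in unitmx -> (1%:M *t A) *m v = 0 -> v = 0.
Proof.
move=> A_unit Av0.
have tens11 : (1%:M : 'M[R]_m) *t (1%:M : 'M[R]_n) = 1%:M.
  apply/matrixP => i j; case: (mxtens_indexP i) => a b.
  case: (mxtens_indexP j) => c d; rewrite tensmxE !mxE -natrM mulnb.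
  by rewrite (can_eq (@mxtens_indexK m n)) xpair_eqE.
by rewrite -[v]mul1mx -tens11 -(mulVmx A_unit) -[1%:M in LHS](mulmx1 1%:M)
  -tensmx_mul -mulmxA Av0 mulmx0.
Qed.

(** Both sides are [zeta x] tensor [A]; this is how constant matrices move from
    outside a Gram representation to its Gram matrix. *)
Lemma zetaI_mulmx (R : realType) (dx dz dzeta : nat)
    (zeta : 'cV[R]_dx -> 'cV[R]_dzeta) x (A : 'M[R]_dz) :
  zetaI dz zeta x *m A = (1%:M *t A) *m zetaI dz zeta x.
Proof. by rewrite kron_mulmx tens1_kron mulmx1 mul1mx. Qed.

(** A congruence by a constant matrix preserves the shape of a Gram
    representation, and acts on the Gram matrix by the congruence with
    [I] tensor [A]. *)
Lemma zetaI_congr (R : realType) (dx dz dzeta : nat)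
    (zeta : 'cV[R]_dx -> 'cV[R]_dzeta) x (S : 'M[R]_(dzeta * dz)) (A : 'M[R]_dz) :
  A^T *m ((zetaI dz zeta x)^T *m S *m zetaI dz zeta x) *m A =
  (zetaI dz zeta x)^T *m ((1%:M *t A)^T *m S *m (1%:M *t A)) *m zetaI dz zeta x.
Proof.
by rewrite !mulmxA -trmx_mul -[_ *m _ *m A]mulmxA zetaI_mulmx trmx_mul !mulmxA.
Qed.

(** The Gram matrix collects the coefficients: row [(a, i)] and column [(b, j)]
    hold the coefficient of [zeta_a zeta_b] in the entry [(i, j)] of [V]. *)
Lemma zetaI_gram_span (R : realType) (dx dz dzeta : nat)
    (zeta : 'cV[R]_dx -> 'cV[R]_dzeta) (V : 'cV[R]_dx -> 'M[R]_dz) :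
  (forall i j, exists c : 'I_(dzeta * dzeta) -> R,
    forall x, V x i j = \sum_l c l * kron (zeta x) (zeta x) l 0) ->
  exists C, forall x, V x = (zetaI dz zeta x)^T *m C *m zetaI dz zeta x.
Proof.
move=> V_span.
have {V_span} /fin_all_exists[c cE] : forall ij : 'I_dz * 'I_dz,
    exists c : 'I_(dzeta * dzeta) -> R,
    forall x, V x ij.1 ij.2 = \sum_l c l * kron (zeta x) (zeta x) l 0.
  by case=> i j; apply: V_span.
pose C : 'M[R]_(dzeta * dz) :=
  \matrix_(p, q) c ((mxtens_unindex p).2, (mxtens_unindex q).2)
    (mxtens_index ((mxtens_unindex p).1, (mxtens_unindex q).1)).
have CE a i b j : C (mxtens_index (a, i)) (mxtens_index (b, j)) =
    c (i, j) (mxtens_index (a, b)) by rewrite mxE !mxtens_indexK.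
exists C => x.
apply/matrixP => i j; rewrite (cE (i, j)) sum_mxtens mxE sum_mxtens exchange_big /=.
apply: eq_bigr => b _; rewrite (bigD1 j) //= [X in _ + X]big1 => [|j' /negPf jj'].
  rewrite addr0 mxE sum_mxtens kronE mxE eqxx mulr1 mulr_suml; apply: eq_bigr => a _.
  rewrite (bigD1 i) //= [X in _ + X]big1 => [|i' /negPf ii'].
    by rewrite CE [_^T _ _]mxE !kronE mxE eqxx /=; ring.
  by rewrite [_^T _ _]mxE kronE [1%:M _ _]mxE ii' mulr0 mul0r.
by rewrite kronE [1%:M _ _]mxE jj' !mulr0.
Qed.

Lemma scale_half_double (R : realType) m n (A : 'M[R]_(m, n)) :
  2^-1 *: (A + A) = A.
Proof. by rewrite scalerDr -scalerDl -div1r -splitr scale1r. Qed.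

(** A scalar equals its transpose, so only the symmetric part of a matrix
    contributes to its quadratic form. *)
Lemma form_symmetrize (R : realType) n (A : 'M[R]_n) (v : 'cV[R]_n) :
  v^T *m (2^-1 *: (A + A^T)) *m v = v^T *m A *m v.
Proof.
have symE : v^T *m A^T *m v = v^T *m A *m v.
  rewrite [RHS]mx11_scalar -tr_scalar_mx -mx11_scalar.
  by rewrite !trmx_mul trmxK mulmxA.
rewrite -scalemxAr -scalemxAl mulmxDr mulmxDl symE.
exact: scale_half_double.
Qed.

(** Each component of [g] is the component of [xi] of some index [s j], so the
    matrix of [s] is a factor. It is injective because [s] is onto: every
    component of [xi] occurs in [g], and distinct indices give distinct
    components. Injectivity is what lets positive definiteness pass from
    [g] to [xi]. *)
Lemma nonredundant_factor (R : realType) d m n (g : 'cV[R]_d -> 'cV[R]_m)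
    (xi : 'cV[R]_d -> 'cV[R]_n) :
  nonredundant_form g xi ->
  exists M : 'M[R]_(m, n),
    (forall x, g x = M *m xi x) /\ forall v : 'cV_n, M *m v = 0 -> v = 0.
Proof.
move=> [_ sub_g /fin_all_exists[s sE] xi_inj].
exists (\matrix_(j, i) (i == s j)%:R).
have ME (v : 'cV[R]_n) j : ((\matrix_(j, i) (i == s j)%:R) *m v) j 0 = v (s j) 0.
  rewrite mxE (bigD1 (s j)) //= mxE eqxx mul1r big1 ?addr0 // => i /negPf is_.
  by rewrite mxE is_ mul0r.
split=> [x|v Mv0]; first by apply/colP => j; rewrite ME sE.
apply/colP => i; have [j jE] := sub_g i.
have -> : i = s j by apply: xi_inj => x; rewrite jE sE.
by rewrite -ME Mv0 !mxE.
Qed.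

(** * The change of variables and the two feasibility problems *)

(** The change of variables [Q = P^-1], [H = W P^-1] that turns the condition
    bilinear in [P] and the gain [W] into one linear in [(Q, H)]: it is the
    congruence by [P]. *)
Lemma U_Y_congr (R : realType) (dx du dz dZ K : nat) (z : 'cV[R]_dx -> 'cV[R]_dz)
    (Z : 'cV[R]_dx -> 'M[R]_(du, dZ)) (F : 'I_K -> 'cV[R]_dx -> 'M[R]_(dx, dz))
    (G : 'I_K -> 'cV[R]_dx -> 'M[R]_(dx, du)) k x (P : 'M[R]_dz) w :
  P^T = P -> P \in unitmx ->
  U z Z F G k x P w = P *m Y z Z F G k x (invmx P) (unvec w *m invmx P) *m P.
Proof.
move=> P_sym P_unit; rewrite /U /Y P_sym.
rewrite scale_half_double.
by rewrite mulmxN mulNmx -!mulmxA mulmxDl -!mulmxA mulVmx // !mulmx1.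
Qed.

Lemma feasibleA_posdef (R : realType) (dx du dz dZ dzeta K : nat)
    (z : 'cV[R]_dx -> 'cV[R]_dz) (zeta : 'cV[R]_dx -> 'cV[R]_dzeta)
    (Z : 'cV[R]_dx -> 'M[R]_(du, dZ)) (F : 'I_K -> 'cV[R]_dx -> 'M[R]_(dx, dz))
    (G : 'I_K -> 'cV[R]_dx -> 'M[R]_(dx, du)) Q H S e :
  feasibleA z zeta Z F G Q H S e -> posdefmx Q /\ forall k, posdefmx (S k).
Proof.
move=> [_ S_ge [_ Q_ge] e_gt0]; split=> [|k]; apply: loewner_ge_posdef e_gt0 _ => //.
by case: (S_ge k).
Qed.

(** The congruence by [Q = P^-1] carries the Gram matrices of the given
    certificate to Gram matrices for (A), which stay positive definite since
    [I] tensor [Q] is invertible. All margins are positive, and finitely many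
    of them have a positive minimum. *)
Lemma feasibleA_exists (R : realType) (dx du dz dZ dzeta K : nat)
    (z : 'cV[R]_dx -> 'cV[R]_dz) (zeta : 'cV[R]_dx -> 'cV[R]_dzeta)
    (Z : 'cV[R]_dx -> 'M[R]_(du, dZ)) (F : 'I_K -> 'cV[R]_dx -> 'M[R]_(dx, dz))
    (G : 'I_K -> 'cV[R]_dx -> 'M[R]_(dx, du)) (P : 'M[R]_dz) w
    (S : 'I_K -> 'M[R]_(dzeta * dz)) :
  posdefmx P -> (forall k, posdefmx (S k)) ->
  (forall k x, U z Z F G k x P w + (U z Z F G k x P w)^T =
    (zetaI dz zeta x)^T *m S k *m zetaI dz zeta x) ->
  exists Q H S' e, feasibleA z zeta Z F G Q H S' e.
Proof.
move=> P_pos S_pos US; have P_unit := posdefmx_unit P_pos.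
have Q_pos := posdefmx_inv P_pos; pose Q := invmx P.
have Q_sym : Q^T = Q by case: Q_pos.
pose S' k := (1%:M *t Q)^T *m S k *m (1%:M *t Q).
have S'_pos k : posdefmx (S' k).
  by apply: posdefmx_congr => // v; apply: tens1_unit_inj; rewrite unitmx_inv.
have [e1 e1_gt0 Q_ge] := posdefmx_loewner_ge Q_pos.
have [e2 e2_gt0 S'_ge] := posdefmx_loewner_ge_fin S'_pos.
exists Q, (unvec w *m Q), S', (Num.min e1 e2); split.
- move=> k x; rewrite -zetaI_congr -US U_Y_congr //; last by case: P_pos.
  set V := Y _ _ _ _ _ _ _ _; rewrite !trmx_mul (proj1 P_pos) Q_sym.
  by rewrite mulmxDr mulmxDl !mulmxA mulVmx // !mul1mx !mulmxK.
- move=> k; split; first by rewrite (proj1 (S'_pos k)).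
  by apply: loewner_ge_le (S'_ge k); rewrite ge_min lexx orbT.
- by split=> //; apply: loewner_ge_le Q_ge; rewrite ge_min lexx.
- by rewrite lt_min e1_gt0.
Qed.

Lemma zetaI_col (R : realType) (dx dz dzeta : nat)
    (zeta : 'cV[R]_dx -> 'cV[R]_dzeta) x (v : 'cV[R]_dz) :
  zetaI dz zeta x *m v = kron (zeta x) v.
Proof. by rewrite kron_mulmx mul1mx. Qed.

Lemma zetaI_form (R : realType) (dx dz dzeta : nat)
    (zeta : 'cV[R]_dx -> 'cV[R]_dzeta) x (C : 'M[R]_(dzeta * dz)) (v : 'cV[R]_dz) :
  v^T *m ((zetaI dz zeta x)^T *m C *m zetaI dz zeta x) *m v =
  (kron (zeta x) v)^T *m C *m kron (zeta x) v.
Proof. by rewrite -zetaI_col trmx_mul !mulmxA. Qed.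

(** Every [z^T U_k z] is a quadratic form in [zeta] tensor [z], hence in [xi], so
    for every [(w, P)] the system without gauge is solvable. Its solutions are
    then an affine space with the same direction for all data, which one gauge
    condition cuts down to a point. *)
Lemma T_wellposed_exists (R : realType) (dx du dz dZ dzeta dxi K : nat)
    (z : 'cV[R]_dx -> 'cV[R]_dz) (zeta : 'cV[R]_dx -> 'cV[R]_dzeta)
    (xi : 'cV[R]_dx -> 'cV[R]_dxi)
    (Z : 'cV[R]_dx -> 'M[R]_(du, dZ)) (F : 'I_K -> 'cV[R]_dx -> 'M[R]_(dx, dz))
    (G : 'I_K -> 'cV[R]_dx -> 'M[R]_(dx, du)) :
  nonredundant_form (fun x => kron (zeta x) (z x)) xi ->
  (forall P w k i j, exists c : 'I_(dzeta * dzeta) -> R,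
    forall x, U z Z F G k x P w i j = \sum_l c l * kron (zeta x) (zeta x) l 0) ->
  exists (dr : nat) (Cr : 'M[R]_(dr, (dxi * dxi.+1)./2)) (cr : bool),
  [/\ (0 < dr)%N, T_wellposed z xi Z F G Cr cr
    & forall v : 'cV[R]_((dxi * dxi.+1)./2), Cr *m v = cr%:R *: (Cr *m v)].
Proof.
move=> /nonredundant_factor[M [kronE_xi _]] U_span.
have [dr [Cr [cr [dr_gt0 gauge Cr_im]]]] := gauge_fixing xi.
exists dr, Cr, cr; split=> // k w P r.
have [C UE] := zetaI_gram_span (U_span P w k).
pose T0 := M^T *m C *m M.
have T0E x : (xi x)^T *m (2^-1 *: (T0 + T0^T)) *m xi x =
    (z x)^T *m U z Z F G k x P w *m z x.
  by rewrite form_symmetrize UE zetaI_form kronE_xi /T0 trmx_mul !mulmxA.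
have T0_sym : (2^-1 *: (T0 + T0^T))^T = 2^-1 *: (T0 + T0^T).
  by rewrite linearZ linearD /= trmxK addrC.
have [T [[T_form CrT T_sym] T_uniq]] := gauge _ T0_sym (col k r).
exists T; split=> [|S [S_form CrS S_sym]].
  by split=> // x; rewrite T_form.
by apply: T_uniq; split=> // x; rewrite S_form.
Qed.

(** Undoing the change of variables, [U_k + U_k^T] has a positive definite Gram
    matrix [S'] in [zeta] tensor [I]; so [z^T U_k z], half the form of
    [U_k + U_k^T], has one in [zeta] tensor [z], and [xi] inherits it through
    the injective factor [M]. *)
Lemma feasibleA_posdef_gram (R : realType) (dx du dz dZ dzeta dxi K : nat)
    (z : 'cV[R]_dx -> 'cV[R]_dz) (zeta : 'cV[R]_dx -> 'cV[R]_dzeta)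
    (xi : 'cV[R]_dx -> 'cV[R]_dxi)
    (Z : 'cV[R]_dx -> 'M[R]_(du, dZ)) (F : 'I_K -> 'cV[R]_dx -> 'M[R]_(dx, dz))
    (G : 'I_K -> 'cV[R]_dx -> 'M[R]_(dx, du)) Q H S e k :
  nonredundant_form (fun x => kron (zeta x) (z x)) xi ->
  feasibleA z zeta Z F G Q H S e ->
  exists T, posdefmx T /\ forall x, (xi x)^T *m T *m xi x =
    (z x)^T *m U z Z F G k x (invmx Q) (vec (H *m invmx Q)) *m z x.
Proof.
move=> /nonredundant_factor[M [kronE_xi M_inj]] feasA.
have [Q_pos S_pos] := feasibleA_posdef feasA; case: feasA => YS _ _ _.
have Q_unit := posdefmx_unit Q_pos; have [P_sym _] := posdefmx_inv Q_pos.
pose S' := (1%:M *t invmx Q)^T *m S k *m (1%:M *t invmx Q).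
have S'_pos : posdefmx S'.
  by apply: posdefmx_congr => // v; apply: tens1_unit_inj; rewrite unitmx_inv.
exists (2^-1 *: (M^T *m S' *m M)); split.
  by apply: posdefmx_scale; rewrite ?invr_gt0 ?ltr0n //; apply: posdefmx_congr.
move=> x; rewrite -[RHS]form_symmetrize U_Y_congr ?unitmx_inv // invmxK vecK mulmxKV //.
set V := Y _ _ _ _ _ _ _ _.
have -> : invmx Q *m V *m invmx Q + (invmx Q *m V *m invmx Q)^T =
    (zetaI dz zeta x)^T *m S' *m zetaI dz zeta x.
  by rewrite -zetaI_congr -YS !trmx_mul P_sym mulmxDr mulmxDl !mulmxA.
by rewrite -!scalemxAr -!scalemxAl zetaI_form kronE_xi trmx_mul !mulmxA.
Qed.

Unset Implicit Arguments.
Set Strict Implicit.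
Set Printing Implicit Defensive.

Theorem theorem5 (R : realType) (dx du dtheta dz dZ dzeta dxi K : nat)
  (Stheta : set 'cV[R]_dtheta)
  (f : 'cV[R]_dx -> 'cV[R]_dtheta -> 'cV[R]_dx)
  (G : 'cV[R]_dx -> 'cV[R]_dtheta -> 'M[R]_(dx, du))
  (h : 'I_K -> 'cV[R]_dtheta -> R)
  (fk : 'I_K -> 'cV[R]_dx -> 'cV[R]_dx)
  (Gk : 'I_K -> 'cV[R]_dx -> 'M[R]_(dx, du))
  (dyn : polytopic Stheta f G h fk Gk)
  (z : 'cV[R]_dx -> 'cV[R]_dz)
  (dzeta_gt0 : (0 < dzeta)%N) (zeta : 'cV[R]_dx -> 'cV[R]_dzeta)
  (xi : 'cV[R]_dx -> 'cV[R]_dxi)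
  (Z : 'cV[R]_dx -> 'M[R]_(du, dZ))
  (mono : bases z zeta xi Z Gk dzeta_gt0)
  (F : 'I_K -> 'cV[R]_dx -> 'M[R]_(dx, dz))
  (uhat : 'cV[R]_dx -> 'cV[R]_(dz * dZ) -> 'cV[R]_du)
  (sos : sos_settings z zeta Z F Gk fk uhat) :
  [/\ (* (i) *)
      exists Q H S eps1, feasibleA z zeta Z F Gk Q H S eps1,
      (* (ii) *)
      forall Q H S eps1, feasibleA z zeta Z F Gk Q H S eps1 ->
      exists (dr : nat) (Cr : 'M[R]_(dr, (dxi * dxi.+1)./2)) (cr : bool),
        [/\ (0 < dr)%N,
            T_wellposed z xi Z F Gk Cr cr
          & exists r eps2, feasibleB z xi Z F Gk Cr cr
              (vec (H *m invmx Q)) (invmx Q) r eps2]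
    & (* (iii) *)
      forall Q H S eps1, feasibleA z zeta Z F Gk Q H S eps1 ->
      forall (dr : nat) (Cr : 'M[R]_(dr, (dxi * dxi.+1)./2)) (cr : bool),
      T_wellposed z xi Z F Gk Cr cr ->
      forall r eps2, feasibleB z xi Z F Gk Cr cr
        (vec (H *m invmx Q)) (invmx Q) r eps2 ->
      posdefmx (invmx Q + (invmx Q)^T) /\
      forall k, posdefmx
        (Tmx z xi Z F Gk Cr cr k (vec (H *m invmx Q)) (invmx Q) r)].
Proof.
have feasA_pos Q H S eps1 : feasibleA z zeta Z F Gk Q H S eps1 -> posdefmx (invmx Q).
  by move=> /feasibleA_posdef[/posdefmx_inv].
have xi_form := bases_xi mono; split.
- have [P [w [P_pos /fin_all_exists[S /all_and2[S_pos US]]]]] := sos_init sos.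
  exact: feasibleA_exists P_pos S_pos US.
- move=> Q H S eps1 feasA.
  have [dr [Cr [cr [dr_gt0 T_wp Cr_im]]]] := T_wellposed_exists xi_form (sos_U_span sos).
  exists dr, Cr, cr; split=> //.
  have /fin_all_exists[T /all_and2[T_pos T_form]] := fun k =>
    feasibleA_posdef_gram k xi_form feasA.
  have [eps2 eps2_gt0 T_ge] := posdefmx_loewner_ge_fin T_pos.
  pose r : 'M[R]_(dr, K) := \matrix_(i, k) (Cr *m vech (T k)) i 0.
  exists r, eps2; split=> // k; suff -> : Tmx z xi Z F Gk Cr cr k
      (vec (H *m invmx Q)) (invmx Q) r = T k by exact: T_ge.
  have T_sys : T_system z xi Z F Gk Cr cr k (vec (H *m invmx Q)) (invmx Q) r (T k).
    split=> //; last by case: (T_pos k).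
    by rewrite Cr_im; congr (_ *: _); apply/colP => i; rewrite !mxE.
  have [T' [_ T_uniq]] := T_wp k (vec (H *m invmx Q)) (invmx Q) r.
  by rewrite -(T_uniq _ T_sys); apply/esym/T_uniq; apply: xgetI T_sys.
- move=> Q H S eps1 /feasA_pos P_pos dr Cr cr _ r eps2 [T_ge eps2_gt0].
  split=> [|k]; last exact: loewner_ge_posdef eps2_gt0 (T_ge k).
  rewrite (proj1 P_pos) -mulr2n -scaler_nat.
  by apply: posdefmx_scale => //; rewrite ltr0n.
Qed.
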